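(* There is a randomized non-adaptive algorithm for $k$-clustering with subset queries which, given $n$, $k$ and any $\delta>0$, makes \[ O\big(n\log\log (n/\delta) \cdot k\log (k/\delta)\big) \] subset queries and, for every hidden $k$-clustering of the $n$-point universe $U$, outputs the hidden clustering exactly with probability at least $1-\delta$.
   Context: Let $U$ be a set of $n$ points with a hidden partition $U=C_1\sqcup\cdots\sqcup C_k$ (a $k$-clustering). A subset query on $S\subseteq U$ returns $\mathsf{count}(S)=|\{i\in[k]: C_i\cap S\neq\emptyset\}|$, the number of clusters intersecting $S$. The query sizes are unrestricted. An algorithm is non-adaptive if its (possibly random) set of queries is fixed before any answer is received; the output is then computed from the answers. *)

(* Defs.v *)
From HB Require Import structures.
From mathcomp Require Import all_boot all_order all_algebra.
From mathcomp Require Import reals exp.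

Set Implicit Arguments.
Unset Strict Implicit.
Unset Printing Implicit Defensive.

Import Order.TTheory GRing.Theory Num.Theory.

Local Open Scope ring_scope.

(* The blocks of a MathComp partition are nonempty, so [P] has exactly [k]
   nonempty clusters; clusters carry no labels. *)
Definition is_kclustering (U : finType) (k : nat) (P : {set {set U}}) : Prop :=
  partition P [set: U] /\ #|P| = k.

Definition subset_count (U : finType) (P : {set {set U}}) (S : {set U}) : nat :=
  #|[set C in P | C :&: S != set0]|.

(* [queries] depends on the random coins only, never on an answer; [decode] may
   read the coins, hence the queries, together with the list of answers. A
   finite coin space is no loss: on a finite universe, once repeated queries
   are dropped, there are finitely many deterministic non-adaptive algorithms
   up to the behaviour of [decode] on the answers that can occur. *)
Record nonadaptive_alg (R : realType) (U : finType) := NonadaptiveAlg {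
  coins : finType;
  coin_prob : coins -> R;
  coin_prob_ge0 : forall w, 0 <= coin_prob w;
  coin_prob_sum1 : \sum_w coin_prob w = 1;
  queries : coins -> seq {set U};
  decode : coins -> seq nat -> {set {set U}}
}.

Definition alg_output (R : realType) (U : finType) (A : nonadaptive_alg R U)
    (P : {set {set U}}) (w : coins A) : {set {set U}} :=
  decode w [seq subset_count P q | q <- queries w].

Definition success_prob (R : realType) (U : finType) (A : nonadaptive_alg R U)
    (P : {set {set U}}) : R :=
  \sum_(w : coins A | alg_output P w == P) coin_prob w.

(* Negative logarithms are truncated to 0. For n >= 3, 1 <= k and delta < 1 both
   logarithms are positive and this is literally
   n log log (n / delta) * k log (k / delta). *)
Definition query_bound (R : realType) (n k : nat) (delta : R) : R :=
  n%:R * Num.max 0 (ln (ln (n%:R / delta)))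
  * (k%:R * Num.max 0 (ln (k%:R / delta))).

(* Main.v *)
(** Fix a set [T] of density [1 / D].  For a test set [Y], comparing the counts
    of [T] and [T :|: Y] tells whether [Y] meets [missed P T], the union of the
    clusters that [T] misses.  Hence these queries determine [missed P T] as soon
    as every point [x] lies in some [Y] with [Y :\ x] disjoint from [missed P T].
    Two clusters, exactly one of which is hit by [T], are then separated in every
    clustering consistent with the answers; once all pairs are separated, a
    consistent clustering refines the hidden one, hence equals it since it also
    has [k] blocks.

    If the larger of two clusters has size about [D], then [T] hits it and misses
    the other one with constant probability, while the expected size of
    [missed P T] is at most [\sum_C |C| (1 - 1/D) ^ |C| <= k D].  So
    [O(k D log n)] random test sets of density about [1 / (k D)] suffice with
    constant probability; alternatively the [n] singletons always do.  Taking the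
    first option for [D <= n / log n] and the second one for the remaining
    [O(log log n)] dyadic scales costs [O(k n log log n)] queries, and
    [O(log (k / delta))] independent repetitions bring the failure probability of
    each of the at most [k ^ 2] pairs below [delta / k ^ 2]. *)
Require Import Defs.
From HB Require Import structures.
From mathcomp Require Import all_boot all_order all_algebra.
From mathcomp Require Import reals exp.
From mathcomp Require Import lra ring zify.

Set Implicit Arguments.
Unset Strict Implicit.
Unset Printing Implicit Defensive.

Import Order.TTheory GRing.Theory Num.Theory.

Local Open Scope ring_scope.

(** * What the answers reveal about a partition *)

Section Partitions.
Variable U : finType.
Implicit Types (P : {set {set U}}) (S T Y C : {set U}) (s : seq {set U}).

Definition missed P T : {set U} := [set x | [disjoint pblock P x & T]].

Lemma missed_eq_block P T x y :
  pblock P x = pblock P y -> (x \in missed P T) = (y \in missed P T).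
Proof. by rewrite !inE => ->. Qed.

Lemma mem_missed P T C x : partition P [set: U] -> C \in P -> x \in C ->
  (x \in missed P T) = [disjoint C & T].
Proof.
by move=> partP PC Cx; rewrite inE (def_pblock (partition_trivIset partP) PC Cx).
Qed.

(** The clusters met by [T] are among those met by [T :|: Y], so equal counts mean equal families:
    [Y] touches no new cluster. *)
Lemma subset_count_setU_eq P T Y : partition P [set: U] ->
  (subset_count P (T :|: Y) == subset_count P T) = [disjoint Y & missed P T].
Proof.
move=> partP; rewrite /subset_count eq_sym.
have sub : [set C in P | C :&: T != set0] \subset
           [set C in P | C :&: (T :|: Y) != set0].
  apply/subsetP => C; rewrite !inE => /andP[-> /=]; apply: contra_neq => e.
  by apply/eqP; rewrite -subset0 -e setIS // subsetUl.
rewrite (subset_leqif_cards sub).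
apply/eqP/pred0P => [e x /= | d].
  apply/negP => /andP[Yx mx].
  have : pblock P x \in [set C in P | C :&: (T :|: Y) != set0].
    rewrite inE pblock_mem ?(cover_partition partP) ?inE //=.
    apply/set0Pn; exists x; rewrite !inE Yx orbT andbT.
    by rewrite mem_pblock (cover_partition partP) inE.
  rewrite -e inE => /andP[_]; move: mx; rewrite inE -setI_eq0 => /eqP ->.
  by rewrite eqxx.
apply/eqP; rewrite eqEsubset sub; apply/subsetP => C; rewrite !inE.
case/andP => PC /set0Pn[x]; rewrite !inE => /andP[Cx TYx]; rewrite PC /=.
case: (boolP (x \in T)) TYx => [Tx _ | _ /= Yx].
  by apply/set0Pn; exists x; rewrite inE Cx.
have := d x; rewrite /= Yx /= (mem_missed T partP PC Cx) -setI_eq0.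
by move=> /negbT.
Qed.

Definition isolates (B : {set U}) x Y := (x \in Y) && [disjoint Y :\ x & B].

(* Every test set [Y] reveals whether it meets [missed P T]; an isolating
   [Y] turns this into a membership test for the isolated point. *)
Lemma missed_determined P P' T s :
    partition P [set: U] -> partition P' [set: U] ->
    [forall x, has (isolates (missed P T) x) s] ->
    let qs := T :: [seq T :|: Y | Y <- s] in
    [seq subset_count P q | q <- qs] = [seq subset_count P' q | q <- qs] ->
  missed P' T = missed P T.
Proof.
move=> partP partP' /forallP iso /= [eT eY].
have eqd Y : Y \in s -> [disjoint Y & missed P T] = [disjoint Y & missed P' T].
  move=> sY; rewrite -!subset_count_setU_eq // eT.
  suff -> : subset_count P (T :|: Y) = subset_count P' (T :|: Y) by [].
  by move: eY => /eq_in_map; apply; apply: map_f.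
have sub : missed P' T \subset missed P T.
  (* If [x] is outside [missed P T], its isolating [Y] avoids [missed P T]; by the answers [Y]
     avoids [missed P' T] too, and it contains [x]. *)
  apply/subsetP => x; apply: contraLR => nx.
  have /hasP[Y sY /andP[Yx dY]] := iso x.
  have: [disjoint Y & missed P T].
    apply/pred0P => z /=; case: (eqVneq z x) => [-> | nezx].
      by rewrite (negPf nx) andbF.
    case: (boolP (z \in Y)) => //= Yz.
    by apply: (disjointFr dY); rewrite !inE nezx.
  by rewrite eqd // => /disjointFr ->.
apply/eqP; rewrite eqEsubset sub; apply/subsetP => x mx.
have /hasP[Y sY /andP[Yx dY]] := iso x.
(* [Y] meets [missed P T] in [x], so it meets [missed P' T] in some [y]; the inclusion just proved
   and isolation leave only [y = x]. *)
have : ~~ [disjoint Y & missed P' T].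
  by rewrite -eqd //; apply/pred0Pn; exists x; rewrite /= Yx.
case/pred0Pn => y /= /andP[Yy my].
case: (eqVneq y x) => [<- // | neyx].
have := subsetP sub _ my.
by rewrite (disjointFr dY) // !inE neyx.
Qed.

(** Phrased through consistent clusterings and not through a decoder, so that it survives adding
    queries; boolean, so that it can index sums of probabilities. *)
Definition separates P C C' s :=
  [forall P' : {set {set U}},
    [&& partition P' [set: U], #|P'| == #|P| &
        [seq subset_count P q | q <- s] == [seq subset_count P' q | q <- s]]
    ==> [forall x in C, forall y in C', pblock P' x != pblock P' y]].

Lemma separates_catl P C C' s1 s2 :
  separates P C C' s1 -> separates P C C' (s1 ++ s2).
Proof.
move=> /forallP h; apply/forallP => P'; have := h P'.
by rewrite !map_cat eqseq_cat ?size_map //; do 3 case: eqP; case: partition.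
Qed.

Lemma separates_catr P C C' s1 s2 :
  separates P C C' s2 -> separates P C C' (s1 ++ s2).
Proof.
move=> /forallP h; apply/forallP => P'; have := h P'.
by rewrite !map_cat eqseq_cat ?size_map //; do 3 case: eqP; case: partition.
Qed.

Lemma separates_sym P C C' s : separates P C C' s -> separates P C' C s.
Proof.
move=> /forallP h; apply/forallP => P'; apply/implyP => hP'.
have /forallP {}h := implyP (h P') hP'.
apply/forallP => x; apply/implyP => xC; apply/forallP => y; apply/implyP => yC.
by rewrite eq_sym; have /forallP /(_ x) /implyP := implyP (h y) yC; apply.
Qed.

(** A consistent clustering has the same missed set, which is a union of its own blocks. This set
    contains [C'] and avoids [C], so no block meets both. *)
Lemma separates_missed P T s C C' :
    partition P [set: U] -> C \in P -> C' \in P ->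
    ~~ [disjoint T & C] -> [disjoint T & C'] ->
    [forall x, has (isolates (missed P T) x) s] ->
  separates P C C' (T :: [seq T :|: Y | Y <- s]).
Proof.
move=> partP PC PC' hC mC' iso; apply/forallP => P'.
apply/implyP => /and3P[partP' _ /eqP e].
have em := missed_determined partP partP' iso e.
apply/forallP => x; apply/implyP => Cx; apply/forallP => y; apply/implyP => Cy.
apply/eqP => /(missed_eq_block T).
rewrite em (mem_missed T partP PC Cx) (mem_missed T partP PC' Cy).
by rewrite disjoint_sym (negPf hC) disjoint_sym mC'.
Qed.

(** A refinement maps its blocks onto those of [P]; equal cardinality makes this map injective, so
    no block of [P] is cut in two. *)
Lemma refines_eq P P' :
    partition P [set: U] -> partition P' [set: U] -> #|P'| = #|P| ->
    (forall x y, pblock P' x = pblock P' y -> pblock P x = pblock P y) ->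
  P' = P.
Proof.
move=> partP partP' cardP h.
have covP x : x \in cover P by rewrite (cover_partition partP) inE.
have covP' x : x \in cover P' by rewrite (cover_partition partP') inE.
(* [f] sends a block of [P'] to the block of [P] around it; blocks are nonempty, so the value [set0]
   does not occur on [P']. *)
pose f (D : {set U}) := if [pick x in D] is Some x then pblock P x else set0.
have fE D x : D \in P' -> x \in D -> f D = pblock P x.
  move=> PD Dx; rewrite /f; case: pickP => [y Dy | /(_ x)]; last by rewrite Dx.
  by apply: h; rewrite !(def_pblock (partition_trivIset partP') PD).
have PE x : pblock P x = f (pblock P' x).
  by rewrite (fE _ x) ?pblock_mem ?mem_pblock.
have Pf : P = f @: P'.
  apply/setP => C; apply/idP/imsetP => [PC | [D PD ->]].
    have /set0Pn[x Cx] := partition_neq0 partP PC.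
    exists (pblock P' x); rewrite ?pblock_mem // -PE.
    by rewrite (def_pblock (partition_trivIset partP) PC Cx).
  have /set0Pn[x Dx] := partition_neq0 partP' PD.
  by rewrite (fE _ x) ?pblock_mem.
have injf : {in P' &, injective f}.
  by apply/imset_injP; rewrite -Pf cardP.
rewrite Pf -[LHS](imset_id); apply: eq_in_imset => D PD /=.
have /set0Pn[x Dx] := partition_neq0 partP' PD.
have DE := def_pblock (partition_trivIset partP') PD Dx.
apply/setP => y; rewrite (fE _ x) //; apply/idP/idP => [Dy | Cy].
  by rewrite (h x y) ?mem_pblock // !(def_pblock (partition_trivIset partP') PD).
have: pblock P x = pblock P y.
  by apply/esym/def_pblock; rewrite ?pblock_mem ?(partition_trivIset partP).
rewrite !PE => /injf; rewrite !pblock_mem // => /(_ isT isT); rewrite DE => ->.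
by rewrite mem_pblock.
Qed.

Lemma separates_all_eq P P' s :
    partition P [set: U] -> partition P' [set: U] -> #|P'| = #|P| ->
    [seq subset_count P q | q <- s] = [seq subset_count P' q | q <- s] ->
    {in P &, forall C C', C != C' -> separates P C C' s} ->
  P' = P.
Proof.
move=> partP partP' cardP e sep; apply: refines_eq => // x y exy.
have covP z : z \in cover P by rewrite (cover_partition partP) inE.
apply/eqP; apply: contraT => nexy.
have /forallP/(_ P') := sep _ _ (pblock_mem (covP x)) (pblock_mem (covP y)) nexy.
rewrite partP' e cardP !eqxx => /forallP/(_ x)/implyP.
rewrite mem_pblock covP => /(_ isT)/forallP/(_ y)/implyP.
by rewrite mem_pblock covP exy eqxx => /(_ isT).
Qed.

Lemma pblock_imset P : partition P [set: U] -> pblock P @: [set: U] = P.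
Proof.
move=> partP; apply/setP => C; apply/imsetP/idP => [[x _ ->] | PC].
  by rewrite pblock_mem ?(cover_partition partP) ?inE.
have /set0Pn[x Cx] := partition_neq0 partP PC.
by exists x; rewrite ?inE ?(def_pblock (partition_trivIset partP) PC Cx).
Qed.

Lemma partition_card_le P : partition P [set: U] -> (#|P| <= #|U|)%N.
Proof.
by move=> /pblock_imset {1}<-; rewrite (leq_trans (leq_imset_card _ _)) ?cardsT.
Qed.

Lemma partition_card_inj P :
  partition P [set: U] -> #|P| = #|U| -> injective (pblock P).
Proof.
move=> partP cardP.
have /imset_injP inj : #|pblock P @: [set: U]| == #|[set: U]|.
  by rewrite pblock_imset // cardsT cardP.
by move=> x y; apply: inj; rewrite inE.
Qed.

End Partitions.

(** * Elementary bounds on powers of [1 - 1/D] *)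

Section PowerBounds.
Variable R : realType.
Implicit Types (x : R) (D c : nat).

Lemma invn_ge0_le1 D : 0 <= (D%:R^-1 : R) <= 1.
Proof.
rewrite invr_ge0 ler0n /=; case: D => [|D]; first by rewrite invr0.
by rewrite invf_le1 ?ltr0n // ler1n.
Qed.

Lemma bernoulli_ge x c : 0 <= x <= 1 -> 1 - c%:R * x <= (1 - x) ^+ c.
Proof.
move=> /andP[x0 x1]; elim: c => [|c IH]; first by rewrite mul0r subr0 expr0.
have h := ler_wpM2l (_ : 0 <= 1 - x) IH.
rewrite exprS; apply: le_trans (h _); last by lra.
rewrite -natr1; have : 0 <= c%:R * x ^+ 2 by rewrite mulr_ge0 ?sqr_ge0.
by rewrite expr2; nra.
Qed.

(** Bernoulli's inequality gives [1 + c x <= (1 + x) ^ c], and [(1 - x) (1 + x) <= 1]. *)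
Lemma bernoulli_le x c : 0 <= x <= 1 -> (1 - x) ^+ c * (1 + c%:R * x) <= 1.
Proof.
move=> /andP[x0 x1].
have h1 : 1 + c%:R * x <= (1 + x) ^+ c.
  elim: c => [|c IH]; first by rewrite mul0r addr0 expr0.
  have h := ler_wpM2l (_ : 0 <= 1 + x) IH.
  rewrite exprS; apply: le_trans (h _); last by lra.
  rewrite -natr1; have : 0 <= c%:R * x ^+ 2 by rewrite mulr_ge0 ?sqr_ge0.
  by rewrite expr2; nra.
apply: (@le_trans _ _ ((1 - x) ^+ c * (1 + x) ^+ c)).
  by apply: ler_wpM2l => //; apply: exprn_ge0; lra.
rewrite -exprMn; apply: exprn_ile1.
  by apply: mulr_ge0; lra.
by have := sqr_ge0 x; rewrite expr2; lra.
Qed.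

Lemma exp_quarter D c : (c <= D.*2)%N -> 1 / 4 <= (1 - D.*2%:R^-1 : R) ^+ c.
Proof.
move=> cD; have [->|D0] := posnP D; first by rewrite invr0 subr0 expr1n; lra.
have /andP[x0 x1] := invn_ge0_le1 D.*2.
apply: (@le_trans _ _ ((1 - D.*2%:R^-1) ^+ D.*2)); last first.
  by apply: ler_wiXn2l cD; lra.
(* Bernoulli's inequality at exponent [2 D] would only give 0, so the exponent is split into two
   halves, each worth 1/2. *)
have h := bernoulli_ge D (invn_ge0_le1 D.*2).
have e : D%:R * D.*2%:R^-1 = 1 / 2 :> R.
  by rewrite -muln2 natrM; field; rewrite pnatr_eq0 -lt0n.
rewrite e in h; rewrite -{2}addnn exprD.
have -> : 1 / 4 = (1 - 1 / 2) * (1 - 1 / 2) :> R by field.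
by apply: ler_pM => //; lra.
Qed.

Lemma exp_half D : (0 < D)%N -> (1 - D%:R^-1 : R) ^+ D <= 1 / 2.
Proof.
move=> D0; have := bernoulli_le D (invn_ge0_le1 D).
by rewrite divff ?pnatr_eq0 -?lt0n //; lra.
Qed.

Lemma exp_half_pow D l : (0 < D)%N -> (1 - D%:R^-1 : R) ^+ (D * l) <= (2 ^ l)%:R^-1.
Proof.
move=> D0; have /andP[x0 x1] := invn_ge0_le1 D.
rewrite exprM natrX -exprVn lerXn2r ?nnegrE ?invr_ge0 ?ler0n ?exprn_ge0 //; first lra.
by have := exp_half D0; lra.
Qed.

Lemma exp_two_thirds D c : (0 < D)%N -> (D <= c.*2)%N ->
  (1 - D%:R^-1 : R) ^+ c <= 2 / 3.
Proof.
move=> D0 cD; have := bernoulli_le c (invn_ge0_le1 D).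
have /andP[x0 x1] := invn_ge0_le1 D.
have : 1 / 2 <= c%:R * D%:R^-1 :> R.
  rewrite ler_pdivlMr ?ltr0n //.
  by move: cD; rewrite -(ler_nat R) -muln2 natrM; lra.
set a := _ ^+ c; have : 0 <= a by apply: exprn_ge0; lra.
by nra.
Qed.

(** The bound is free of [c]: a block of any size contributes at most [D] to the expected number of
    missed points. *)
Lemma mul_exp_le D c : (0 < D)%N -> c%:R * (1 - D%:R^-1 : R) ^+ c <= D%:R.
Proof.
move=> D0; have := bernoulli_le c (invn_ge0_le1 D).
have /andP[x0 x1] := invn_ge0_le1 D.
set a := _ ^+ c; have a0 : 0 <= a by apply: exprn_ge0; lra.
have Dp : 0 < D%:R :> R by rewrite ltr0n.
move=> h; have := ler_wpM2l (ltW Dp) h.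
have -> : D%:R * (a * (1 + c%:R / D%:R)) = a * D%:R + c%:R * a.
  by field; rewrite gt_eqF.
rewrite mulr1; apply: le_trans.
by rewrite lerDr mulr_ge0 // ltW.
Qed.

End PowerBounds.

(** * Random sets containing each point independently with probability [1/D] *)

Section Bernoulli.
Variables (R : realType) (U : finType).
Implicit Types (S T C B : {set U}) (D : nat).

Definition bern D T : R :=
  \prod_x (if x \in T then D%:R^-1 else 1 - D%:R^-1).

Lemma bern_ge0 D T : 0 <= bern D T.
Proof.
have /andP[x0 x1] := invn_ge0_le1 R D.
by apply: prodr_ge0 => x _; case: ifP; lra.
Qed.

Lemma bern_disjoint D C :
  \sum_(T : {set U} | [disjoint T & C]) bern D T = (1 - D%:R^-1) ^+ #|C|.
Proof.
(* [F] is the weight for containing a point, set to 0 on [C]; expanding the product then kills the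
   sets that meet [C]. *)
pose F x : R := if x \in C then 0 else D%:R^-1.
transitivity (\prod_x (F x + (1 - D%:R^-1))).
  rewrite bigA_distr big_mkcond; apply: eq_bigr => T _.
  case: ifP => [dTC | /negbT /pred0Pn[x /andP[/= Tx Cx]]].
    apply: eq_bigr => x _; case: ifP => // Tx.
    by rewrite /F (disjointFr dTC Tx).
  by rewrite (bigD1 x) //= Tx /F Cx mul0r.
rewrite (bigID (mem C)) /= [X in _ * X]big1 ?mulr1.
  rewrite -prodr_const; apply: eq_bigr => x Cx.
  by rewrite /F Cx add0r.
by move=> x Cx; rewrite /F (negPf Cx) addrC subrK.
Qed.

Lemma bern_sum1 D : \sum_(T : {set U}) bern D T = 1.
Proof.
rewrite -[RHS](expr0 (1 - D%:R^-1)) -(cards0 U) -bern_disjoint.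
by apply: eq_bigl => T; rewrite disjoint_sym disjoints_subset sub0set.
Qed.

(** Of the sets missing [C'], those that also miss [C] are the sets missing [C :|: C']; subtract
    their probability. *)
Lemma bern_hit_miss D C C' : [disjoint C & C'] ->
  \sum_(T : {set U} | ~~ [disjoint T & C] && [disjoint T & C']) bern D T =
  (1 - D%:R^-1) ^+ #|C'| * (1 - (1 - D%:R^-1) ^+ #|C|).
Proof.
move=> dCC'; have := bern_disjoint D C'.
rewrite (bigID (fun T => [disjoint T & C])) /=.
rewrite (eq_bigl (fun T => [disjoint T & C :|: C'])); last first.
  by move=> T; rewrite -!setI_eq0 setIUr setU_eq0 andbC.
rewrite bern_disjoint cardsU.
rewrite (_ : C :&: C' = set0) ?cards0 ?subn0; last by apply/eqP; rewrite setI_eq0.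
rewrite exprD => e; apply: (addrI ((1 - D%:R^-1) ^+ #|C| * (1 - D%:R^-1) ^+ #|C'|)).
transitivity ((1 - D%:R^-1) ^+ #|C'| : R); last by ring.
rewrite -[RHS]e; congr (_ + _).
by apply: eq_bigl => T; rewrite andbC.
Qed.

Lemma bern_isolates D B x :
  \sum_(T : {set U} | isolates B x T) bern D T = (1 - D%:R^-1) ^+ #|B :\ x| / D%:R.
Proof.
have := @bern_hit_miss D [set x] (B :\ x).
rewrite disjoints1 !inE eqxx cards1 expr1 subKr => /(_ isT) <-.
apply: eq_bigl => T; rewrite disjoint_sym disjoints1 negbK /isolates.
congr (_ && _); rewrite -!setI_eq0; congr (_ == _).
by apply/setP => y; rewrite !inE; case: (y == x); rewrite ?andbF.
Qed.

(** Linearity of expectation over points, then summation block by block: a point of [C] is missed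
    with probability [(1 - 1/D) ^ #|C|]. *)
Lemma bern_card_missed D P : (0 < D)%N -> partition P [set: U] ->
  \sum_(T : {set U}) bern D T * #|missed P T|%:R <= (#|P| * D)%:R.
Proof.
move=> D0 partP.
have -> : \sum_(T : {set U}) bern D T * #|missed P T|%:R =
          \sum_x (1 - D%:R^-1) ^+ #|pblock P x| :> R.
  transitivity (\sum_(T : {set U}) \sum_x if x \in missed P T then bern D T else 0).
    apply: eq_bigr => T _; rewrite -big_mkcond /= sumr_const.
    by rewrite mulr_natr.
  rewrite exchange_big; apply: eq_bigr => x _.
  rewrite -big_mkcond /= -bern_disjoint.
  by apply: eq_bigl => T; rewrite inE disjoint_sym.
rewrite (eq_bigl (fun x => x \in cover P)); last first.
  by move=> x; rewrite (cover_partition partP) inE.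
rewrite big_trivIset ?(partition_trivIset partP) //=.
rewrite natrM mulr_natl -sumr_const; apply: ler_sum => C PC.
rewrite (eq_bigr (fun=> (1 - D%:R^-1) ^+ #|C|)); last first.
  by move=> x Cx; rewrite (def_pblock (partition_trivIset partP) PC Cx).
by rewrite sumr_const -[X in X <= _]mulr_natl mul_exp_le.
Qed.

End Bernoulli.

(** * Random query lists and their failure probabilities *)

Section Schemes.
Variables (R : realType) (U : finType).
Implicit Types (S T Y C B : {set U}) (D : nat) (s : seq {set U}).
Implicit Types (P : {set {set U}}).

Record scheme := Scheme {
  scoin : finType;
  swt : scoin -> R;
  swt_ge0 : forall w, 0 <= swt w;
  swt_sum1 : \sum_w swt w = 1;
  sqs : scoin -> seq {set U}
}.
Implicit Types (A : scheme) (Q : pred (seq {set U})).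

Definition fail A Q : R := \sum_(w : scoin A | ~~ Q (sqs w)) swt w.

Lemma fail_ge0 A Q : 0 <= fail A Q.
Proof. by apply: sumr_ge0 => w _; apply: swt_ge0. Qed.

Lemma fail_le1 A Q : fail A Q <= 1.
Proof.
by rewrite -(swt_sum1 A) /fail big_mkcond ler_sum // => w _; case: ifP; rewrite ?swt_ge0.
Qed.

Lemma fail_le A Q Q' : (forall s, Q' s -> Q s) -> fail A Q <= fail A Q'.
Proof.
move=> QQ'; rewrite /fail big_mkcond [leRHS]big_mkcond ler_sum // => w _.
case: ifP => [nQ | _]; last by case: ifP; rewrite ?swt_ge0.
by rewrite (contra (QQ' _) nQ).
Qed.

Lemma fail_forall (I : finType) A (Q : I -> pred (seq {set U})) (J : {pred I}) :
  fail A (fun s => [forall i in J, Q i s]) <= \sum_(i in J) fail A (Q i).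
Proof.
rewrite /fail; under [leRHS]eq_bigr do rewrite big_mkcond.
rewrite exchange_big big_mkcond ler_sum // => w _.
have ge0 : 0 <= \sum_(i in J) (if ~~ Q i (sqs w) then swt w else 0) :> R.
  by apply: sumr_ge0 => i _; case: ifP; rewrite ?swt_ge0.
case: ifP => // /forallPn[i]; rewrite negb_imply => /andP[Ji nQ].
rewrite (bigD1 i) //= nQ lerDl.
by apply: sumr_ge0 => j _; case: ifP; rewrite ?swt_ge0.
Qed.

Program Definition cat_scheme A A' : scheme :=
  @Scheme (scoin A * scoin A')%type (fun w => swt w.1 * swt w.2) _ _
    (fun w => sqs w.1 ++ sqs w.2).
Next Obligation. by move=> A A' w /=; rewrite mulr_ge0 ?swt_ge0. Qed.
Next Obligation.
move=> A A'; rewrite -(pair_bigA _ (fun i j => swt i * swt j)) /=.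
by rewrite -[RHS]mulr1 -{1}(swt_sum1 A) -(swt_sum1 A') big_distrlr.
Qed.

(** Success survives the addition of queries; hence a concatenation of independent schemes fails
    only if every part fails. *)
Definition cat_stable Q := forall s1 s2, Q s1 || Q s2 -> Q (s1 ++ s2).

Lemma fail_cat A A' Q : cat_stable Q ->
  fail (cat_scheme A A') Q <= fail A Q * fail A' Q.
Proof.
move=> Qcat; rewrite /fail big_distrlr pair_big big_mkcond [leRHS]big_mkcond.
apply: ler_sum => -[w w'] _ /=; case: ifP => [/(contra (Qcat _ _)) | _].
  by rewrite negb_or => ->.
by case: ifP => //; rewrite mulr_ge0 ?swt_ge0.
Qed.

Program Definition det_scheme s : scheme :=
  @Scheme unit (fun=> 1) _ _ (fun=> s).
Next Obligation. by move=> *; apply: ler01. Qed.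
Next Obligation. by move=> *; rewrite sumr_const card_unit. Qed.

Lemma fail_det s Q : Q s -> fail (det_scheme s) Q = 0.
Proof. by move=> Qs; rewrite /fail big1 //= => w; rewrite Qs. Qed.

Definition cat_schemes := foldr cat_scheme (det_scheme [::]).

Lemma fail_cats (As : seq scheme) Q : cat_stable Q ->
  fail (cat_schemes As) Q <= \prod_(A <- As) fail A Q.
Proof.
move=> Qcat; elim: As => [|A As IH]; first by rewrite big_nil fail_le1.
rewrite big_cons (le_trans (fail_cat _ _ Qcat)) //.
by rewrite ler_wpM2l ?fail_ge0.
Qed.

Lemma fail_cats_nth (As : seq scheme) i Q : cat_stable Q ->
  (i < size As)%N -> fail (cat_schemes As) Q <= fail (nth (det_scheme [::]) As i) Q.
Proof.
move=> Qcat ltiA; apply: le_trans (fail_cats _ Qcat) _.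
rewrite (big_nth (det_scheme [::])) big_mkord (bigD1 (Ordinal ltiA)) //=.
by rewrite ler_piMr ?fail_ge0 // prodr_ile1 // => j _; rewrite fail_ge0 fail_le1.
Qed.

Definition pow_scheme A t := cat_schemes (nseq t A).

Lemma fail_pow A t Q : cat_stable Q -> fail (pow_scheme A t) Q <= fail A Q ^+ t.
Proof.
by move=> Qcat; apply: le_trans (fail_cats _ Qcat) _; rewrite big_nseq iter_mulr_1.
Qed.

Definition size_bound A m := forall w : scoin A, (size (sqs w) <= m)%N.

Lemma size_bound_cats (I : Type) (r : seq I) (F : I -> scheme) (f : I -> nat) :
    (forall i, size_bound (F i) (f i)) ->
  size_bound (cat_schemes [seq F i | i <- r]) (\sum_(i <- r) f i).
Proof.
move=> Ff; elim: r => [|i r IH] w /=; first by rewrite big_nil.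
by rewrite big_cons size_cat; apply: leq_add; [apply: Ff | apply: IH].
Qed.

Lemma size_bound_pow A m t : size_bound A m -> size_bound (pow_scheme A t) (t * m).
Proof.
move=> Am; elim: t => [|t IH] w //=.
by rewrite size_cat mulSn; apply: leq_add; [apply: Am | apply: IH].
Qed.

(** * Probing with a random set [T] and independent test sets *)

Program Definition probe_scheme D A : scheme :=
  @Scheme ({set U} * scoin A)%type (fun w => bern R D w.1 * swt w.2) _ _
    (fun w => w.1 :: [seq w.1 :|: Y | Y <- sqs w.2]).
Next Obligation. by move=> D A w /=; rewrite mulr_ge0 ?swt_ge0 ?bern_ge0. Qed.
Next Obligation.
move=> D A; rewrite -(pair_bigA _ (fun i j => bern R D i * swt j)) /=.
by rewrite -[RHS]mulr1 -{1}(bern_sum1 R U D) -(swt_sum1 A) big_distrlr.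
Qed.

Lemma size_bound_probe D A m : size_bound A m -> size_bound (probe_scheme D A) m.+1.
Proof. by move=> Am w /=; rewrite size_map ltnS. Qed.

Definition all_isolated B s := [forall x, has (isolates B x) s].

Lemma cat_stable_has (p : pred {set U}) : cat_stable (has p).
Proof. by move=> s1 s2; rewrite has_cat. Qed.

Lemma cat_stable_separates P C C' : cat_stable (separates P C C').
Proof. by move=> s1 s2 /orP[/separates_catl|/separates_catr]. Qed.

(** Markov's inequality for the size of the missed set. *)
Lemma bern_large_missed D P c : (0 < D)%N -> (0 < #|P|)%N -> (0 < c)%N ->
    partition P [set: U] ->
  \sum_(T : {set U} | (c * (#|P| * D) < #|missed P T|)%N) bern R D T <= c%:R^-1.
Proof.
move=> D0 P0 c0 partP.
have PD0 : 0 < (#|P| * D)%:R :> R by rewrite ltr0n muln_gt0 P0.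
have c0' : 0 < c%:R :> R by rewrite ltr0n.
rewrite -(ler_pM2r (mulr_gt0 c0' PD0)) mulKf ?gt_eqF //.
apply: le_trans (bern_card_missed R D0 partP).
rewrite big_distrl big_mkcond ler_sum //= => T _.
case: ifP => [/ltnW le | _]; last by rewrite mulr_ge0 ?bern_ge0.
by rewrite ler_wpM2l ?bern_ge0 // -natrM ler_nat.
Qed.

(** [T] hits [C] with probability at least 1/3 and misses [C'] with probability at least 1/4,
    independently by disjointness: 1/12 in all. Markov's inequality discards 1/24; on the remaining
    1/24 the test sets succeed with probability 1/2, which leaves 1/48. *)
Lemma fail_probe (d : nat) A P C C' :
    partition P [set: U] -> C \in P -> C' \in P -> C != C' ->
    (0 < d)%N -> (d <= #|C|)%N -> (#|C'| <= d.*2)%N ->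
    (forall B, (#|B| <= 24 * (#|P| * d.*2))%N -> fail A (all_isolated B) <= 1 / 2) ->
  fail (probe_scheme d.*2 A) (separates P C C') <= 47 / 48.
Proof.
move=> partP PC PC' neCC' d0 dC C'd iso.
have P0 : (0 < #|P|)%N by apply/card_gt0P; exists C.
have D0 : (0 < d.*2)%N by rewrite double_gt0.
have dCC' : [disjoint C & C'].
  by have /trivIsetP := partition_trivIset partP; apply.
pose hm T := ~~ [disjoint T & C] && [disjoint T & C'].
pose big T := (24 * (#|P| * d.*2) < #|missed P T|)%N.
have phm : 1 / 12 <= \sum_(T | hm T) bern R d.*2 T.
  rewrite bern_hit_miss //.
  have h1 := exp_quarter R C'd.
  have h2 : (1 - d.*2%:R^-1 : R) ^+ #|C| <= 2 / 3.
    by rewrite exp_two_thirds // leq_double.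
  have -> : 1 / 12 = 1 / 4 * (1 - 2 / 3) :> R by field.
  by apply: ler_pM; lra.
have pbig : \sum_(T | big T) bern R d.*2 T <= 24%:R^-1.
  exact: bern_large_missed.
have pgood : 1 / 24 <= \sum_(T | hm T && ~~ big T) bern R d.*2 T.
  have : \sum_(T | hm T) bern R d.*2 T <=
      \sum_(T | big T) bern R d.*2 T + \sum_(T | hm T && ~~ big T) bern R d.*2 T.
    rewrite big_mkcond [X in _ <= X + _]big_mkcond [X in _ <= _ + X]big_mkcond.
    rewrite -big_split ler_sum //= => T _.
    by case: (hm T); case: (big T); rewrite /= ?addr0 ?add0r ?bern_ge0.
  by lra.
(* For fixed [T] the factor [bern] comes out. A good [T] fails on at most half of its weight; any
   other [T] is counted as failing. *)
have : fail (probe_scheme d.*2 A) (separates P C C') <=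
    \sum_(T : {set U}) (bern R d.*2 T - 1 / 2 * (if hm T && ~~ big T then bern R d.*2 T else 0)).
  rewrite /fail big_mkcond /=.
  rewrite -(pair_bigA _ (fun T w =>
    if ~~ separates P C C' (T :: [seq T :|: Y | Y <- @sqs A w])
    then bern R d.*2 T * swt w else 0)) /=.
  apply: ler_sum => T _.
  have -> : \sum_(w : scoin A) (if ~~ separates P C C' (T :: [seq T :|: Y | Y <- sqs w])
      then bern R d.*2 T * swt w else 0) =
      bern R d.*2 T * fail A (fun s => separates P C C' (T :: [seq T :|: Y | Y <- s])).
    by rewrite /fail mulr_sumr [RHS]big_mkcond.
  have b0 := bern_ge0 R d.*2 T.
  case: ifP => [/andP[/andP[hC mC'] nbig] | _].
    have : fail A (fun s => separates P C C' (T :: [seq T :|: Y | Y <- s])) <= 1 / 2.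
      apply: le_trans (iso (missed P T) _); last by rewrite leqNgt.
      by apply: fail_le => s; apply: separates_missed.
    by nra.
  by rewrite mulr0 subr0 ler_piMr // fail_le1.
rewrite big_split sumrN -mulr_sumr -big_mkcond bern_sum1 /=.
by lra.
Qed.

(** * Test families that isolate every point *)

Program Definition bern_scheme D : scheme :=
  @Scheme {set U} (bern R D) _ _ (fun Y => [:: Y]).
Next Obligation. exact: bern_ge0. Qed.
Next Obligation. exact: bern_sum1. Qed.

(** [x] is chosen with probability [1 / (2 d)], and the at most [2 d] other points of [B] are all
    avoided with probability at least 1/4. *)
Lemma fail_bern_isolates d B x : (0 < d)%N -> (#|B| <= d.*2)%N ->
  fail (bern_scheme d.*2) (has (isolates B x)) <= 1 - (4 * d.*2)%:R^-1.
Proof.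
move=> d0 Bd.
have := bern_sum1 R U d.*2; rewrite (bigID (isolates B x)) /= bern_isolates.
have -> : fail (bern_scheme d.*2) (has (isolates B x)) =
    \sum_(T : {set U} | ~~ isolates B x T) bern R d.*2 T.
  by apply: eq_bigl => T /=; rewrite orbF.
have : 1 / 4 <= (1 - d.*2%:R^-1 : R) ^+ #|B :\ x|.
  apply: exp_quarter; apply: leq_trans Bd; apply: subset_leq_card.
  exact: subsetDl.
rewrite natrM invfM.
have /andP[i0 _] := invn_ge0_le1 R d.*2.
set a := _ ^+ _; set b := _^-1 in i0 *; nra.
Qed.

(** A batch of [4 * d.*2] test sets halves the failure probability for one point; [l] batches allow
    a union bound over all points. *)
Lemma fail_pow_bern_isolated d l B :
    (0 < d)%N -> (#|B| <= d.*2)%N -> (2 * #|U| <= 2 ^ l)%N ->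
  fail (pow_scheme (bern_scheme d.*2) (4 * d.*2 * l)) (all_isolated B) <= 1 / 2.
Proof.
move=> d0 Bd Ul.
have h := @fail_forall U (pow_scheme (bern_scheme d.*2) (4 * d.*2 * l))
            (fun x => has (isolates B x)) predT.
apply: le_trans (le_trans h _); first exact: fail_le.
apply: (@le_trans _ _ (\sum_(x in U) (2 ^ l)%:R^-1)).
  apply: ler_sum => x _.
  apply: le_trans (fail_pow _ _ (@cat_stable_has (isolates B x))) _.
  have d4 : (0 < 4 * d.*2)%N by rewrite muln_gt0 double_gt0.
  apply: le_trans (exp_half_pow R l d4).
  have hx := fail_bern_isolates x d0 Bd.
  by rewrite lerXn2r ?nnegrE ?fail_ge0 // (le_trans (fail_ge0 _ _) hx).
rewrite sumr_const -[X in X <= _]mulr_natl ler_pdivrMr ?ltr0n ?expn_gt0 //.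
by move: Ul; rewrite -(ler_nat R) natrM; lra.
Qed.

Definition singleton_scheme := det_scheme [seq [set x] | x <- enum U].

Lemma fail_singleton B : fail singleton_scheme (all_isolated B) = 0.
Proof.
apply: fail_det; apply/forallP => x; apply/hasP; exists [set x].
  by rewrite map_f ?mem_enum.
by rewrite /isolates set11 setDv -setI_eq0 set0I eqxx.
Qed.

Lemma size_bound_singleton : size_bound singleton_scheme #|U|.
Proof. by move=> w; rewrite /= size_map -cardE. Qed.

Lemma size_bound_bern D : size_bound (bern_scheme D) 1.
Proof. by []. Qed.

End Schemes.

(** * One round over all dyadic scales *)

Section Rounds.
Variables (R : realType) (U : finType).
Implicit Types (C : {set U}) (P : {set {set U}}) (k j : nat).

Local Notation n := #|U|.
Local Notation l := (trunc_log 2 n).+2.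

(* Scale [j] takes care of clusters of size about [2 ^ j].  Random tests are
   cheaper than singletons exactly when [2 ^ j] is below about [n / log n], so
   that only [O(log log n)] scales pay [n] queries. *)
Definition inner_scheme k j : scheme R U :=
  if (2 ^ j * l <= n)%N then
    pow_scheme (bern_scheme R U (24 * (k * 2 ^ j)).*2) (4 * (24 * (k * 2 ^ j)).*2 * l)
  else singleton_scheme R U.

Definition scale_scheme k j := probe_scheme (2 ^ j).*2 (inner_scheme k j).

Definition round_scheme k :=
  cat_schemes [seq scale_scheme k j | j <- iota 0 (trunc_log 2 n).+1].

Lemma two_mul_le_exp_trunc_log m : (2 * m <= 2 ^ (trunc_log 2 m).+2)%N.
Proof. by rewrite expnS leq_mul2l /= ltnW // trunc_log_ltn. Qed.

(** With [j] the scale of the larger cluster, [2 ^ j <= #|C|] and both sizes are below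
    [2 ^ (j + 1)]: the size window of [fail_probe]. *)
Lemma fail_scale P C C' : partition P [set: U] -> C \in P -> C' \in P ->
    C != C' -> (#|C'| <= #|C|)%N ->
  fail (scale_scheme #|P| (trunc_log 2 #|C|)) (separates P C C') <= 47 / 48.
Proof.
move=> partP PC PC' neCC' leC; set j := trunc_log 2 #|C|.
have P0 : (0 < #|P|)%N by apply/card_gt0P; exists C.
have C0 : (0 < #|C|)%N.
  by rewrite card_gt0; apply: partition_neq0 partP PC.
have /andP[jC Cj] := trunc_log_bounds (isT : 1 < 2)%N C0.
apply: fail_probe => //; first by rewrite expn_gt0.
  by rewrite (leq_trans leC) // ltnW // -mul2n -expnS.
move=> B HB; rewrite /inner_scheme; case: ifP => _; last by rewrite fail_singleton; lra.
apply: fail_pow_bern_isolated; first by rewrite !muln_gt0 P0 expn_gt0.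
  by move: HB; rewrite doubleMr doubleMr.
exact: two_mul_le_exp_trunc_log.
Qed.

(** By symmetry [C] is the larger cluster. The one scale matching its size suffices, as the queries
    of the other scales do no harm. *)
Lemma fail_round P C C' : partition P [set: U] -> C \in P -> C' \in P ->
  C != C' -> fail (round_scheme #|P|) (separates P C C') <= 47 / 48.
Proof.
move=> partP.
wlog leC : C C' / (#|C'| <= #|C|)%N => [hw | PC PC' neCC'].
  move=> PC PC' neCC'; have [le | /ltnW le] := leqP #|C'| #|C|; first exact: hw.
  apply: le_trans (hw C' C le PC' PC _); last by rewrite eq_sym.
  by apply: fail_le => s; apply: separates_sym.
apply: le_trans (fail_scale partP PC PC' neCC' leC).
set j := trunc_log 2 #|C|.
have ltj : (j < (trunc_log 2 n).+1)%N by rewrite ltnS leq_trunc_log // max_card.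
have := @fail_cats_nth R U [seq scale_scheme #|P| j | j <- iota 0 (trunc_log 2 n).+1] j
  _ (@cat_stable_separates U P C C').
rewrite size_map size_iota => /(_ ltj).
by rewrite (nth_map 0%N) ?size_iota // nth_iota.
Qed.

(** [192 = 4 * 24 * 2] comes from the random test sets; the successor counts the query [T]
    itself. *)
Definition scale_size k j := (if 2 ^ j * l <= n then 192 * k * (2 ^ j * l) else n)%N.+1.

Lemma size_bound_round k :
  size_bound (round_scheme k) (\sum_(j <- iota 0 (trunc_log 2 n).+1) scale_size k j).
Proof.
apply: size_bound_cats => j; apply: size_bound_probe.
rewrite /inner_scheme; case: ifP => _; last exact: size_bound_singleton.
rewrite (_ : 192 * _ * _ = 4 * (24 * (k * 2 ^ j)).*2 * l * 1)%N.
  exact/size_bound_pow/size_bound_bern.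
by rewrite -muln2; lia.
Qed.

Lemma sum_scale_size k : (0 < k)%N -> (0 < n)%N ->
  (\sum_(j <- iota 0 (trunc_log 2 n).+1) scale_size k j <= 388 * k * n * up_log 2 l)%N.
Proof.
move=> k0 n0; set e := trunc_log 2 n; set v := up_log 2 l.
have e2 : (2 ^ e <= n)%N by apply: trunc_logP.
have l2 : (l <= 2 ^ v)%N by apply: up_logP.
have v0 : (0 < v)%N by rewrite up_log_gt0.
have small a : (\sum_(0 <= j < a) (if 2 ^ j * l <= n then 2 ^ j * l else 0) <= 2 * n)%N.
  have low b : (\sum_(0 <= j < b) (if 2 ^ j * l <= n then 2 ^ j * l else 0) <= 2 ^ b * l)%N.
    elim: b => [|b IH]; first by rewrite big_geq.
    by rewrite big_nat_recr //= expnS -mulnA mul2n -addnn leq_add //; case: ifP.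
  elim: a => [|a IH]; first by rewrite big_geq.
  (* At a cheap scale the earlier terms add up to at most the current one, hence to at most [n]. *)
  rewrite big_nat_recr //=; case: ifP => [le | _]; last by rewrite addn0.
  by rewrite mul2n -addnn leq_add // (leq_trans (low a)).
have large a : (a <= e.+1)%N ->
    (\sum_(0 <= j < a) (if 2 ^ j * l <= n then 0 else 1) <= a - (e.+1 - v))%N.
  elim: a => [|a IH] lea; first by rewrite big_geq.
  rewrite big_nat_recr //=; have {}IH := IH (ltnW lea).
  case: ifP => [_ | /negbT]; first by rewrite addn0 (leq_trans IH) // leq_sub2r.
  (* An expensive scale [a] exceeds [e - v], since [a + v <= e] would give
     [2 ^ a * l <= 2 ^ e <= n]. So at most [v] scales are expensive. *)
  rewrite -ltnNge => lt; suff h : (e.+1 - v <= a)%N by rewrite addn1 subSn.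
  rewrite leqNgt; apply/negP => lt'.
  have : (2 ^ a * l <= n)%N.
    apply: leq_trans e2; apply: leq_trans (leq_mul (leqnn _) l2) _.
    by rewrite -expnD leq_exp2l //; lia.
  by rewrite leqNgt lt.
have -> : iota 0 e.+1 = index_iota 0 e.+1 by rewrite /index_iota subn0.
apply: (@leq_trans (\sum_(0 <= j < e.+1)
   (193 * k * (if 2 ^ j * l <= n then 2 ^ j * l else 0)
    + (n + 1) * (if 2 ^ j * l <= n then 0 else 1)))%N).
  apply: leq_sum => j _; rewrite /scale_size; case: ifP => _; last by lia.
  have : (0 < k * (2 ^ j * l))%N by rewrite !muln_gt0 k0 expn_gt0.
  by rewrite muln0 addn0 -!mulnA; lia.
rewrite big_split -!big_distrr /=.
have := small e.+1; have := large e.+1 (leqnn _).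
set x := (\sum_(_ <= _ < _) _)%N; set y := (\sum_(_ <= _ < _) _)%N => hx hy.
have {}hx : (x <= v)%N by lia.
have kn : (k * n <= k * n * v)%N by rewrite leq_pmulr.
have nv : (n * v <= k * n * v)%N by rewrite leq_mul // leq_pmull.
have h1 : (193 * k * y <= 193 * k * (2 * n))%N by rewrite leq_mul.
have h2 : ((n + 1) * x <= 2 * n * v)%N by rewrite leq_mul //; lia.
apply: (leq_trans (leq_add h1 h2)).
have -> : (193 * k * (2 * n) = 386 * (k * n))%N by ring.
have -> : (388 * k * n * v = 388 * (k * n * v))%N by ring.
have -> : (2 * n * v = 2 * (n * v))%N by ring.
by move: (k * n * v)%N (k * n)%N (n * v)%N kn nv; lia.
Qed.

End Rounds.

(** * Decoding by consistency *)

Section Decoding.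
Variables (R : realType) (U : finType).
Implicit Types (P : {set {set U}}) (A : scheme R U).

(** Exhaustive search for a consistent [k]-clustering. A hidden [k]-clustering is itself consistent,
    so the default [set0] is then not reached. *)
Definition alg_of_scheme (k : nat) A : nonadaptive_alg R U :=
  NonadaptiveAlg (@swt_ge0 R U A) (swt_sum1 A) (@sqs R U A)
    (fun w ans => odflt set0 [pick P | [&& partition P [set: U], #|P| == k
                      & [seq subset_count P q | q <- sqs w] == ans]]).

Lemma success_prob_ge0 (k : nat) A P : 0 <= success_prob (alg_of_scheme k A) P.
Proof. by apply: sumr_ge0 => w _; apply: swt_ge0. Qed.

(** Union bound over ordered pairs of clusters: once all are separated, [P] is the only candidate
    for the decoder. *)
Lemma success_prob_ge k A P : is_kclustering k P ->
  1 - \sum_(c in [pred c : {set U} * {set U} | [&& c.1 \in P, c.2 \in P & c.1 != c.2]])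
        fail A (separates P c.1 c.2)
  <= success_prob (alg_of_scheme k A) P.
Proof.
move=> [partP cardP].
rewrite lerBlDl; set J := [pred c | _].
apply: le_trans (lerD (@fail_forall R U _ A (fun c => separates P c.1 c.2) J) (lexx _)).
rewrite -(swt_sum1 A).
rewrite (bigID (fun w => [forall c in J, separates P c.1 c.2 (sqs w)])) /=.
rewrite addrC /fail lerD2l /success_prob.
rewrite big_mkcond [leRHS]big_mkcond ler_sum // => w _.
case: ifP => [/forallP sep | _]; last by case: ifP; rewrite ?swt_ge0.
suff -> : alg_output (A := alg_of_scheme k A) P w = P by rewrite eqxx.
rewrite /alg_output /=; case: pickP => [P' | /(_ P)]; last first.
  by rewrite partP cardP !eqxx.
case/and3P => partP' /eqP cardP' /eqP e /=.
apply: (@separates_all_eq _ _ _ (sqs w)); rewrite ?cardP //.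
move=> C C' PC PC' ne; have /implyP := sep (C, C').
by apply; rewrite /J inE /= PC PC'.
Qed.

End Decoding.

(** * Integer logarithms against natural ones *)

Section Logarithms.
Variable R : realType.
Implicit Types (n k : nat) (delta : R).

Lemma ln3_gt1 : 1 < ln (3%:R : R).
Proof.
(* The power [(6/5) ^ 6] is just below 3, and [ln (5/6) <= -1/6]. *)
have h : 1 / 6 <= ln (6 / 5 : R).
  have := @le_ln1Dx R (- (1 / 6)); rewrite (_ : 1 + - (1 / 6) = (6 / 5)^-1); last by field.
  by rewrite lnV ?posrE; lra.
apply: (@le_lt_trans _ _ (ln ((6 / 5 : R) ^+ 6))); first by rewrite lnXn; lra.
by rewrite ltr_ln ?posrE; lra.
Qed.

Lemma ln2_gt0 : 0 < ln (2%:R : R).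
Proof. by rewrite ln_gt0 // ltr1n. Qed.

Lemma lnln3_gt0 : 0 < ln (ln (3%:R : R)).
Proof. by rewrite ln_gt0 // ln3_gt1. Qed.

(** The additive term [ln (8 / ln 2)] is absorbed into [ln (ln n)] by means of
    [ln (ln 3) <= ln (ln n)]. *)
Definition loglog_const : R := (ln (8 / ln 2) / ln (ln 3%:R) + 1) / ln 2.

Lemma ln_8_ln2_ge0 : 0 <= ln (8 / ln 2 : R).
Proof.
have l2 := ln2_gt0; have := ln_sublinear (ltr0n R 2).
by move=> h; rewrite ln_ge0 // ler_pdivlMr // mul1r; lra.
Qed.

Lemma loglog_const_gt0 : 0 < loglog_const.
Proof.
by rewrite divr_gt0 ?ln2_gt0 // ltr_wpDl // divr_ge0 ?ln_8_ln2_ge0 // ltW ?lnln3_gt0.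
Qed.

Lemma up_log_le_lnln n : (3 <= n)%N ->
  (up_log 2 (trunc_log 2 n).+2)%:R <= loglog_const * ln (ln n%:R).
Proof.
move=> n3; set e := trunc_log 2 n; set v := up_log 2 _.
have l2 := ln2_gt0.
have nat_n0 : (0 < n)%N by rewrite (leq_trans _ n3).
have n0 : 0 < n%:R :> R by rewrite ltr0n.
have e1 : (1 <= e)%N by rewrite trunc_log_gt0 (leq_trans _ n3).
(* Minimality of [v] gives [2 ^ (v - 1) < e + 2], and [e >= 1]. *)
have ve : (2 ^ v <= 8 * e)%N.
  have v0 : (0 < v)%N by rewrite up_log_gt0.
  have := up_log_gtn (isT : 1 < 2)%N (isT : 1 < e.+2)%N.
  by rewrite -/v -{2}(prednK v0) expnS; lia.
have ln_n : e%:R * ln 2 <= ln (n%:R : R).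
  rewrite mulr_natl -lnXn ?ltr0n // ler_ln ?posrE ?exprn_gt0 ?ltr0n //.
  by rewrite -natrX ler_nat trunc_logP.
have lnn : 1 < ln (n%:R : R).
  by apply: lt_le_trans ln3_gt1 _; rewrite ler_ln ?posrE ?ltr0n // ler_nat.
have hv : v%:R * ln 2 <= ln (8 / ln 2 : R) + ln (ln (n%:R : R)).
  rewrite -lnM ?posrE ?divr_gt0 //; last by lra.
  rewrite mulr_natl -lnXn ?ltr0n // ler_ln ?posrE ?exprn_gt0 ?ltr0n ?mulr_gt0 ?invr_gt0 //; last by lra.
  apply: (@le_trans _ _ (8 * e%:R)).
    by rewrite -natrX -natrM ler_nat.
  rewrite -mulrA ler_pM2l ?ltr0n // mulrC ler_pdivlMr //.
have lnln : ln (ln 3%:R) <= ln (ln (n%:R : R)).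
  have := ln3_gt1 => l3.
  by rewrite !ler_ln ?posrE ?ltr0n ?ler_nat //; lra.
rewrite /loglog_const mulrAC ler_pdivlMr //; apply: le_trans hv _.
rewrite [leRHS]mulrDl mul1r lerD2r -mulrA ler_peMr ?ln_8_ln2_ge0 //.
by rewrite mulrC ler_pdivlMr ?lnln3_gt0 // mul1r.
Qed.

Definition doublings k delta := (Num.truncn (ln (k%:R ^+ 2 / delta) / ln 2)).+1.

Lemma doublings_ge k delta : (0 < k)%N -> 0 < delta ->
  k%:R ^+ 2 / delta <= (2 ^ doublings k delta)%:R.
Proof.
move=> k0 d0; have l2 := ln2_gt0.
rewrite natrX -ler_ln ?posrE ?exprn_gt0 ?ltr0n // ?divr_gt0 ?exprn_gt0 ?ltr0n //.
rewrite lnXn ?ltr0n // -[leRHS]mulr_natl -ler_pdivrMr //.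
exact/ltW/truncnS_gt.
Qed.

(** Rounding up costs [ln 2 <= ln k], which turns [2 ln k - ln delta] into at most
    [3 (ln k - ln delta)]. *)
Lemma doublings_le k delta : (2 <= k)%N -> 0 < delta < 1 ->
  (doublings k delta)%:R <= 3 / ln 2 * ln (k%:R / delta).
Proof.
move=> k2 /andP[d0 d1]; have l2 := ln2_gt0.
have nat_k0 : (0 < k)%N by rewrite (leq_trans _ k2).
have k0 : 0 < k%:R :> R by rewrite ltr0n.
have h2 : ln 2 <= ln (k%:R : R) by rewrite ler_ln ?posrE ?ltr0n // ler_nat.
have hd : ln delta <= 0 by rewrite ln_le0 // ltW.
have e : ln (k%:R ^+ 2 / delta) = 2 * ln k%:R - ln delta.
  by rewrite ln_div ?posrE ?exprn_gt0 // lnXn // mulr_natl.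
rewrite ln_div ?posrE // mulrAC ler_pdivlMr // /doublings -[X in X * _]natr1.
have t0 : 0 <= ln (k%:R ^+ 2 / delta) / ln 2.
  by rewrite divr_ge0 ?(ltW l2) // e; lra.
have : (Num.truncn (ln (k%:R ^+ 2 / delta) / ln 2))%:R <= ln (k%:R ^+ 2 / delta) / ln 2.
  by rewrite truncn_le.
by rewrite ler_pdivlMr // mulrDl e; lra.
Qed.

End Logarithms.

(** * The algorithm and its parameters *)

Section Algorithm.
Variable R : realType.
Implicit Types (n k : nat) (delta : R).

(** No query is made in the degenerate cases, where the bound can drop below 1: [delta >= 1] makes
    the claim trivial, [k < 2] leaves no pair to separate, and [n <= 2 <= k] forces singletons. *)
Definition clustering_scheme n k delta : scheme R 'I_n :=
  if [&& (3 <= n)%N, (2 <= k)%N & delta < 1]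
  then pow_scheme (round_scheme R 'I_n k) (48 * doublings k delta)%N
  else det_scheme R [::].

Definition bound_const : R := 48 * 388 * loglog_const R * (3 / ln 2).

Lemma query_bound_ge0 n k delta : 0 <= query_bound n k delta.
Proof. by rewrite !mulr_ge0 // le_max lexx. Qed.

Lemma bound_const_gt0 : 0 < bound_const.
Proof.
have l2 := ln2_gt0 R; have lc := loglog_const_gt0 R.
by apply: mulr_gt0; [apply: mulr_gt0 => //; lra | apply: divr_gt0].
Qed.

Lemma size_clustering_scheme n k delta (w : scoin (clustering_scheme n k delta)) :
  0 < delta -> (size (sqs w))%:R <= bound_const * query_bound n k delta.
Proof.
move=> d0; move: w; rewrite /clustering_scheme; case: ifP => [/and3P[n3 k2 d1] | _] w; last first.
  by rewrite mulr_ge0 ?query_bound_ge0 // ltW ?bound_const_gt0.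
have k0 : (0 < k)%N by rewrite (leq_trans _ k2).
have n0 : (0 < n)%N by rewrite (leq_trans _ n3).
have := size_bound_pow (@size_bound_round R 'I_n k) w.
have := @sum_scale_size 'I_n k k0; rewrite card_ord => /(_ n0) h1 h2.
have {h1 h2} h : (size (sqs w) <= 48 * doublings k delta * (388 * k * n * up_log 2 (trunc_log 2 n).+2))%N.
  by apply: leq_trans h2 _; rewrite leq_mul2l h1 orbT.
have d01 : 0 < delta < 1 by rewrite d0.
have hu := doublings_le k2 d01.
have hv := up_log_le_lnln R n3.
have n0' : 0 < n%:R :> R by rewrite ltr0n.
have nd : n%:R <= n%:R / delta.
  by rewrite ler_pdivlMr // ler_piMr // ltW.
have lnn : 1 < ln (n%:R : R).
  by apply: lt_le_trans (ln3_gt1 R) _; rewrite ler_ln ?posrE ?ltr0n // ler_nat.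
have lnnd : ln n%:R <= ln (n%:R / delta) by rewrite ler_ln ?posrE ?divr_gt0.
have {}hv : (up_log 2 (trunc_log 2 n).+2)%:R <=
    loglog_const R * Num.max 0 (ln (ln (n%:R / delta))).
  apply: le_trans hv _; rewrite ler_pM2l ?loglog_const_gt0 // le_max; apply/orP; right.
  by rewrite ler_ln ?posrE //; lra.
have {}hu : (doublings k delta)%:R <= 3 / ln 2 * Num.max 0 (ln (k%:R / delta)).
  apply: le_trans hu _; rewrite ler_pM2l ?divr_gt0 ?ltr0n ?ln2_gt0 //.
  by rewrite le_max lexx orbT.
move: h; rewrite -(ler_nat R) => /le_trans; apply.
have huv := ler_pM (ler0n R _) (ler0n R _) hu hv.
have kn : 0 <= 48 * 388 * (k%:R * n%:R) :> R by rewrite !mulr_ge0.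
have := ler_wpM2l kn huv; rewrite /bound_const /query_bound !natrM.
set a := Num.max _ _; set b := Num.max _ _.
set u := (doublings k delta)%:R; set v := (up_log 2 _)%:R.
set x := loglog_const R; set y := (3 / ln 2) => hh.
by apply: le_trans (le_trans hh _); rewrite le_eqVlt; apply/orP; left; apply/eqP; ring.
Qed.

Lemma success_clustering_scheme n k delta (P : {set {set 'I_n}}) :
    0 < delta -> is_kclustering k P ->
  1 - delta <= success_prob (alg_of_scheme k (clustering_scheme n k delta)) P.
Proof.
move=> d0 clP; have [d1 | d1] := leP 1 delta.
  by apply: le_trans (success_prob_ge0 _ _ _); lra.
have [partP cardP] := clP.
apply: le_trans (success_prob_ge _ clP); rewrite lerD2l lerN2.
rewrite /clustering_scheme d1 andbT; case: ifP => [/andP[n3 k2] | small].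
  have k0 : (0 < k)%N by rewrite (leq_trans _ k2).
  set J := [pred c | _].
  apply: (@le_trans _ _ (\sum_(c in J) (2 ^ doublings k delta)%:R^-1)).
    apply: ler_sum => -[C C']; rewrite inE => /and3P[/= PC PC' neCC'].
    apply: le_trans (fail_pow _ _ (@cat_stable_separates _ P C C')) _.
    (* As [47/48 = 1 - 1/48], every 48 rounds at least halve the failure probability. *)
    apply: le_trans (exp_half_pow R (doublings k delta) (isT : 0 < 48)%N).
    have := fail_round R partP PC PC' neCC'; rewrite cardP => h.
    by rewrite lerXn2r ?nnegrE ?fail_ge0 //; lra.
  rewrite sumr_const -[X in X <= _]mulr_natl.
  have cJ : (#|J| <= k ^ 2)%N.
    apply: (@leq_trans #|setX P P|); last by rewrite cardsX cardP -mulnn.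
    apply: subset_leq_card; apply/subsetP => -[C C'].
    by rewrite !inE => /and3P[-> ->].
  have h := doublings_ge k0 d0.
  rewrite ler_pdivrMr ?ltr0n ?expn_gt0 //.
  move: h; rewrite ler_pdivrMr // mulrC; apply: le_trans.
  by rewrite -natrX ler_nat.
rewrite big1 ?ltW // => -[C C']; rewrite inE => /and3P[/= PC PC' neCC'].
have k2 : (2 <= k)%N.
  rewrite -cardP; apply: leq_trans (subset_leq_card (_ : [set C; C'] \subset P)).
    by rewrite cards2 neCC'.
  by apply/subsetP => D; rewrite !inE => /orP[] /eqP ->.
have kn := partition_card_le partP; rewrite cardP card_ord in kn.
(* From [2 <= k <= n] and [n <= 2] follows [k = n], so even without queries every candidate consists
   of singletons. *)
have nk : #|P| = #|'I_n| by rewrite cardP card_ord; lia.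
apply: fail_det; apply/forallP => P'; apply/implyP => /and3P[partP' /eqP cardP' _].
apply/forallP => x; apply/implyP => Cx; apply/forallP => y; apply/implyP => Cy.
apply: contra_neq neCC' => /(partition_card_inj partP' (etrans cardP' nk)) exy.
have trivP := partition_trivIset partP.
by rewrite -(def_pblock trivP PC Cx) -(def_pblock trivP PC' Cy) exy.
Qed.

End Algorithm.

Theorem theorem2p3 (R : realType) :
  exists (A : forall (n k : nat) (delta : R), nonadaptive_alg R 'I_n) (c : R),
    0 < c /\
    forall (n k : nat) (delta : R), 0 < delta ->
      (forall w : coins (A n k delta),
         (size (queries w))%:R <= c * query_bound n k delta) /\
      (forall P : {set {set 'I_n}}, is_kclustering k P ->
         1 - delta <= success_prob (A n k delta) P).
Proof.
exists (fun n k delta => alg_of_scheme k (clustering_scheme n k delta)), (bound_const R).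
split=> [|n k delta d0]; first exact: bound_const_gt0.
split=> [w | P clP]; first exact: size_clustering_scheme.
exact: success_clustering_scheme.
Qed.
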